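(* Let $p\in[1,\infty]$, let $u^{\mathrm{scb}}$ and $u^{\mathrm a}$ be the (lattice-interpolated) linearised surface Cauchy–Born solution and the linearised atomistic solution defined in the context, and let $$\mathrm{Err}_p:=\frac{\|u^{\mathrm{scb}}-u^{\mathrm a}\|_{\ell^p}}{\|u^{\mathrm a}\|_{\ell^p}}.$$ If $h_0>1$, then, as $\alpha\to\infty$, $$\mathrm{Err}_p=C_p+O(e^{-\alpha}),$$ where $C_p$ is a constant independent of $\alpha$ with $\tfrac12\le C_p\le2$. If $h_0=1$, then, as $\alpha\to\infty$, $$\mathrm{Err}_p=2^{1/p}e^{-\alpha}+O(e^{-2\alpha}),$$ with the convention $2^{1/\infty}=1$.
   Context: Morse potential: for the stiffness parameter $\alpha\ge 1+\sqrt3$, $$\phi(r)=e^{-2\alpha(r-r_0)}-2e^{-\alpha(r-r_0)}-\phi_0,\qquad r_0=1+\frac1\alpha\log\Big(\frac{1+2e^{-\alpha}}{1+2e^{-2\alpha}}\Big),\qquad r\in\mathbb{R}.$$ $W(r):=\phi(r)+\phi(2r)$; the value of $r_0$ is such that $W'(1)=0$, and the constant $\phi_0$ is chosen such that $W(1)=0$. The surface energy is $\gamma(F):=-\tfrac12\phi(2F)$. The mesh is a strictly increasing integer sequence $0=X_0<X_1<\dots$, independent of $\alpha$, with $h_j:=X_{j+1}-X_j$. Linearised surface Cauchy–Born solution: $$U^{\mathrm{scb}}_0=\frac{-\gamma'(1)}{h_0W''(1)+\gamma''(1)},\qquad U^{\mathrm{scb}}_j=0\quad(j\ge1).$$ It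 is the solution of $\delta E(0)+\delta^2E(0)U=0$ for $E(U)=\sum_{j\ge0}h_jW(1+U_j)+\gamma(1+U_0)$. It is interpolated to a lattice function $u^{\mathrm{scb}}=(u^{\mathrm{scb}}_\ell)_{\ell\ge0}$ by $u^{\mathrm{scb}}_\ell=U^{\mathrm{scb}}_j$ for $\ell=X_j,\dots,X_{j+1}-1$, $j\ge0$. Linearised atomistic solution: $$u^{\mathrm a}_\ell=\frac{\phi'(2)\lambda^\ell}{\phi''(1)+\phi''(2)(1+\lambda)}\quad(\ell\ge0),$$ where $\lambda$ is the unique solution in $(0,1)$ of $\phi''(2)\lambda^2+[\phi''(1)+2\phi''(2)]\lambda+\phi''(2)=0$, that is, $$\lambda=\frac{\sqrt{1+4\beta}-1-2\beta}{2\beta},\qquad \beta=\frac{\phi''(2)}{\phi''(1)}.$$ It is the decaying solution of $\delta E(0)+\delta^2E(0)u=0$ for $E(u)=\sum_{\ell\ge0}[\phi(1+u_\ell)+\phi(2+u_\ell+u_{\ell+1})]$. (The linearised pure Cauchy–Born solution is $u^{\mathrm{cb}}=0$, so $\mathrm{Err}_p$ is the error of the surface Cauchy–Born solution relative to that of the Cauchy–Born solution.) *)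

(* Defs.v *)
(* MathComp-Analysis *)
From mathcomp Require Import all_boot all_order all_algebra.
From mathcomp Require Import all_classical all_reals all_analysis.

Set Implicit Arguments.
Unset Strict Implicit.
Unset Printing Implicit Defensive.

Import Order.TTheory GRing.Theory Num.Theory.
Import numFieldNormedType.Exports.

Local Open Scope ring_scope.
Local Open Scope classical_set_scope.

Definition mesh_size (X : nat -> nat) (j : nat) : nat := (X j.+1 - X j)%N.

Section morse.
Context {R : realType}.
Implicit Types (al r F : R).

Definition r0 al : R :=
  1 + al^-1 * ln ((1 + 2 * expR (- al)) / (1 + 2 * expR (- (2 * al)))).

Definition morse al r : R :=
  expR (- (2 * al * (r - r0 al))) - 2 * expR (- (al * (r - r0 al))).

(* The normalisation W 1 = 0 below reads
   morse al 1 + morse al 2 - 2 * phi0 al = 0. *)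
Definition phi0 al : R := (morse al 1 + morse al 2) / 2.

Definition phi al r : R := morse al r - phi0 al.

Definition W al r : R := phi al r + phi al (2 * r).

Definition gamma al F : R := - (1 / 2) * phi al (2 * F).

Definition Uscb al (X : nat -> nat) (j : nat) : R :=
  if j is 0%N then
    - derive1 (gamma al) 1 /
      ((mesh_size X 0)%:R * derive1n 2 (W al) 1 + derive1n 2 (gamma al) 1)
  else 0.

(* For X strictly increasing with X 0 = 0, the index used here is the unique j
   with X j <= l < X j.+1; searching j <= l suffices because j <= X j. *)
Definition interpolate (X : nat -> nat) (U : nat -> R) (l : nat) : R :=
  U (\max_(j < l.+1 | (X j <= l)%N) j)%N.

Definition uscb al (X : nat -> nat) : nat -> R := interpolate X (Uscb al X).

Definition beta al : R := derive1n 2 (phi al) 2 / derive1n 2 (phi al) 1.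

(* The root in ]0, 1[ of
   phi''(2) t^2 + (phi''(1) + 2 phi''(2)) t + phi''(2) = 0. *)
Definition lambda al : R :=
  (Num.sqrt (1 + 4 * beta al) - 1 - 2 * beta al) / (2 * beta al).

Definition ua al (l : nat) : R :=
  derive1 (phi al) 2 * lambda al ^+ l /
    (derive1n 2 (phi al) 1 + derive1n 2 (phi al) 2 * (1 + lambda al)).

(* The sequence norm on l^p: the L^p norm for the counting measure on nat,
   p : \bar R so that p = +oo is included. *)
Definition lp_norm (p : \bar R) (u : nat -> R) : \bar R :=
  Lnorm (@counting nat R) p (EFin \o u).

(* fine is harmless: for al large lambda al is in ]0, 1[, so ua al is geometric
   and both norms are finite (uscb al X has finite support). *)
Definition Err (X : nat -> nat) (p : \bar R) al : R :=
  fine (lp_norm p (fun l => uscb al X l - ua al l)) / fine (lp_norm p (ua al)).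

(* 2^(1/p), with 2^(1/oo) = 1; the value at p = -oo is irrelevant. *)
Definition two_root (p : \bar R) : R :=
  if p is q%:E then 2 `^ q^-1 else 1.

End morse.

(* Main.v *)
(* Put x = exp (-al) and b = - phi''(2) / phi''(1) = x + O(x^2).  Up to a common
   nonzero factor the atomistic solution is lambda^l with lambda = b + O(b^2),
   and the surface Cauchy-Born solution is rho on the first cell {0, .., h0-1},
   so Err_p = ||rho 1_[l < h0] - lambda^l||_p / ||lambda^l||_p, where
   rho = 1/h0 + O(x) in general and rho = 1 + x + O(x^2) when h0 = 1.  Hence the
   denominator is 1 + O(x), and the numerator is ||1_[l < h0]/h0 - delta_0||_p
   + O(x) when h0 > 1 and x ||delta_0 - delta_1||_p + O(x^2) when h0 = 1. *)
Require Import Defs.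
From mathcomp Require Import all_boot all_order all_algebra.
From mathcomp Require Import all_classical all_reals all_analysis.
From mathcomp Require Import ring lra ess_sup_inf.

Set Implicit Arguments.
Unset Strict Implicit.
Unset Printing Implicit Defensive.

Import Order.TTheory GRing.Theory Num.Theory.
Import numFieldNormedType.Exports.

Local Open Scope ring_scope.
Local Open Scope classical_set_scope.

(** * Sequence norms: domination by l^1, scaling, Minkowski, the dipole *)

Section lp_norm.
Context {R : realType}.
Implicit Types (p : \bar R) (q a B : R) (u v : nat -> R).

(** Trades an extended-real series for its real partial sums: they increase to the series, and
    [q]-th powers are monotone. Later norm bounds for finite exponents go through this. *)
Lemma lp_norm_le_powR q u B : 0 < q -> 0 <= B ->
  (forall n, \sum_(k < n) `|u k| `^ q <= B `^ q) <-> (lp_norm q%:E u <= B%:E)%E.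
Proof.
move=> q0 B0; rewrite /lp_norm Lnorm_counting//.
set S := (\sum_(k <oo) _)%E.
have SE : S = (\sum_(k <oo) (`|u k| `^ q)%:E)%E by [].
have S0 : (0 <= S)%E by apply: nneseries_ge0 => *; exact: poweR_ge0.
have -> : (S `^ q^-1 <= B%:E)%E <-> (S <= (B `^ q)%:E)%E.
  split=> h.
    rewrite -(poweRe1 S0) -(mulVf (lt0r_neq0 q0)) poweRrM -poweR_EFin.
    by apply: (gt0_ler_poweR (ltW q0)) => //; rewrite in_itv/= leey ?poweR_ge0 ?lee_fin ?B0.
  have -> : B = (B `^ q) `^ q^-1 by rewrite -powRrM mulfV ?lt0r_neq0// powRr1.
  rewrite -poweR_EFin.
  apply: gt0_ler_poweR => //; first by rewrite invr_ge0 ltW.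
    by rewrite in_itv/= S0 leey.
  by rewrite in_itv/= leey lee_fin powR_ge0.
split=> h.
  rewrite SE; apply: lime_le.
    by apply: is_cvg_nneseries => k _ _; rewrite lee_fin powR_ge0.
  by apply: nearW => n; rewrite sumEFin lee_fin big_mkord.
move=> n; rewrite -lee_fin -sumEFin -(big_mkord xpredT (fun k => (`|u k| `^ q)%:E)).
apply: le_trans h; rewrite SE.
by apply: nneseries_lim_ge => k _ _; rewrite lee_fin powR_ge0.
Qed.

Lemma lp_norm_le_sup u B :
  (forall k, `|u k| <= B) <-> (lp_norm +oo u <= B%:E)%E.
Proof.
rewrite /lp_norm unlock ifT; last first.
  by rewrite /= /counting asboolF//; exact: infinite_nat.
split=> [h|/ess_supP].
  by apply/ess_supP; apply: nearW => k; rewrite /= lee_fin.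
move=> [N [mN N0 hN]] k; apply: contrapT => kB.
(* A violating index would lie in the null set [N], yet a singleton has counting measure 1; so the
   essential supremum is a true supremum. *)
have /hN Nk : (~` [set k | ((abse \o (EFin \o u)) k <= B%:E)%E]) k.
  by rewrite /= lee_fin.
have : (counting [set k] <= (counting N : \bar R))%E.
  by apply: le_measure; rewrite ?inE// => _ ->.
rewrite N0 /= /counting asboolT; last exact: finite_set1.
by rewrite fset_set1 finmap.cardfs1 lee_fin ler10.
Qed.

Lemma lp_norm_ge0 p u : (0 <= lp_norm p u)%E.
Proof. exact: Lnorm_ge0. Qed.

(** Each term is at most [B], hence |u k|^q <= B^(q-1) |u k|, and summation gives B^q. *)
Lemma lp_norm_le_sum p u B : (1 <= p)%E ->
  (forall n, \sum_(k < n) `|u k| <= B) -> (lp_norm p u <= B%:E)%E.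
Proof.
move=> p1 h.
have B0 : 0 <= B by have := h 0%N; rewrite big_ord0.
have hk k : `|u k| <= B.
  apply: le_trans (h k.+1); rewrite big_ord_recr/= lerDr.
  exact: sumr_ge0.
case: p p1 => [q| |]//= q1; last exact/lp_norm_le_sup.
rewrite lee_fin in q1; have q0 : 0 < q by exact: lt_le_trans q1.
apply/lp_norm_le_powR => // n.
have -> : B `^ q = B `^ (q - 1) * B.
  by rewrite -(mulr_powRB1 B0 q0) mulrC.
apply: (@le_trans _ _ (\sum_(k < n) B `^ (q - 1) * `|u k|)).
  apply: ler_sum => k _; rewrite -(mulr_powRB1 _ q0)// mulrC ler_wpM2r//.
  by apply: ge0_ler_powR; rewrite ?nnegrE// subr_ge0.
by rewrite -mulr_sumr ler_wpM2l ?powR_ge0.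
Qed.

Lemma lp_norm_ge_term p u k : (1 <= p)%E -> (`|u k|%:E <= lp_norm p u)%E.
Proof.
move=> p1; have [pu|] := boolP (lp_norm p u \is a fin_num); last first.
  by rewrite ge0_fin_numE ?lp_norm_ge0// -leNgt leye_eq => /eqP ->; rewrite leey.
rewrite -(fineK pu) lee_fin.
have B0 : 0 <= fine (lp_norm p u) by rewrite fine_ge0 ?lp_norm_ge0.
have : (lp_norm p u <= (fine (lp_norm p u))%:E)%E by rewrite fineK.
case: p p1 pu B0 => [q| |]//= q1 pu B0; last by move=> /lp_norm_le_sup.
rewrite lee_fin in q1; have q0 : 0 < q by exact: lt_le_trans q1.
move=> /(lp_norm_le_powR _ q0 B0)/(_ k.+1); rewrite big_ord_recr/= => h.
have {}h : `|u k| `^ q <= (fine (lp_norm q%:E u)) `^ q.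
  apply: le_trans h; rewrite lerDr; apply: sumr_ge0 => *; exact: powR_ge0.
rewrite leNgt; apply/negP => /(gt0_ltr_powR q0) h'.
by move: h; rewrite leNgt h'// nnegrE.
Qed.

Lemma le_lp_normD p u v : (1 <= p)%E ->
  (lp_norm p (fun k => u k + v k)%R <= lp_norm p u + lp_norm p v)%E.
Proof. by move=> p1; apply: eminkowski. Qed.

Lemma lp_norm_leZ p a u : (1 <= p)%E -> (lp_norm p u < +oo)%E ->
  (lp_norm p (fun k => a * u k)%R <= (`|a| * fine (lp_norm p u))%:E)%E.
Proof.
move=> p1 ufin; have pu : lp_norm p u \is a fin_num.
  by rewrite ge0_fin_numE ?lp_norm_ge0.
have B0 : 0 <= fine (lp_norm p u) by rewrite fine_ge0 ?lp_norm_ge0.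
have : (lp_norm p u <= (fine (lp_norm p u))%:E)%E by rewrite fineK.
case: p p1 ufin pu B0 => [q| |]//= q1 ufin pu B0; last first.
  move=> /lp_norm_le_sup h; apply/lp_norm_le_sup => k.
  by rewrite normrM ler_wpM2l.
rewrite lee_fin in q1; have q0 : 0 < q by exact: lt_le_trans q1.
move=> /(lp_norm_le_powR _ q0 B0) h.
apply/lp_norm_le_powR => //; first by rewrite mulr_ge0.
move=> n; under eq_bigr do rewrite normrM powRM//.
by rewrite -mulr_sumr powRM// ler_wpM2l ?powR_ge0.
Qed.

Lemma lp_normZ p a u : (1 <= p)%E -> a != 0 -> (lp_norm p u < +oo)%E ->
  fine (lp_norm p (fun k => a * u k)) = `|a| * fine (lp_norm p u).
Proof.
move=> p1 a0 ufin; have h1 := lp_norm_leZ a p1 ufin.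
have aufin := le_lt_trans h1 (ltry _).
(* Scaling back by [a^-1] turns the one-sided bound into an equality. *)
have := lp_norm_leZ a^-1 p1 aufin.
under [fun k => a^-1 * _]eq_fun do rewrite mulKf//.
move: h1; rewrite -{1}[lp_norm p (fun k => a * u k)]fineK ?ge0_fin_numE ?lp_norm_ge0//.
rewrite -{2}[lp_norm p u]fineK ?ge0_fin_numE ?lp_norm_ge0// !lee_fin normfV.
rewrite [_^-1 * _]mulrC ler_pdivlMr ?normr_gt0// => h1 h2.
by apply/eqP; rewrite eq_le h1 mulrC.
Qed.

(* The l^1 norm dominates every l^p norm, so a single termwise estimate serves
   for all p. *)
Lemma lp_norm_dist p u v B : (1 <= p)%E -> (lp_norm p v < +oo)%E ->
  (forall n, \sum_(k < n) `|u k - v k| <= B) ->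
  `|fine (lp_norm p u) - fine (lp_norm p v)| <= B.
Proof.
move=> p1 vfin h.
have huv : (lp_norm p (fun k => u k - v k)%R <= B%:E)%E by exact: lp_norm_le_sum.
have hvu : (lp_norm p (fun k => v k - u k)%R <= B%:E)%E.
  by apply: lp_norm_le_sum => // n; under eq_bigr do rewrite distrC.
have := le_lp_normD (fun k => u k - v k) v p1.
under eq_fun do rewrite subrK.
move=> /le_trans/(_ (leeD2r _ huv)) h1.
(* The first Minkowski inequality also gives finiteness of the norm of [u], so that [fine] loses
   nothing. *)
have ufin : (lp_norm p u < +oo)%E.
  by apply: le_lt_trans h1 _; rewrite lte_add_pinfty ?ltry.
have := le_lp_normD (fun k => v k - u k) u p1.
under eq_fun do rewrite subrK.
move=> /le_trans/(_ (leeD2r _ hvu)); move: h1.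
have -> : lp_norm p u = (fine (lp_norm p u))%:E.
  by rewrite fineK// ge0_fin_numE ?lp_norm_ge0.
have -> : lp_norm p v = (fine (lp_norm p v))%:E.
  by rewrite fineK// ge0_fin_numE ?lp_norm_ge0.
rewrite /= -!EFinD !lee_fin => h1 h2.
by rewrite ler_norml; lra.
Qed.

(** The dipole is the leading error profile when the first cell has one site; its norm is the
    constant in the second claim. *)
Lemma lp_norm_dipole p : (1 <= p)%E ->
  lp_norm p (fun k => (k == 0%N)%:R - (k == 1%N)%:R : R) = (two_root p)%:E.
Proof.
move=> p1; set u := fun k => _.
have u0 : `|u 0%N| = 1 by rewrite /u/= subr0 normr1.
have u1 : `|u 1%N| = 1 by rewrite /u/= sub0r normrN normr1.
have u2 k : `|u k.+2| = 0 by rewrite /u/= subr0 normr0.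
have pfin : lp_norm p u \is a fin_num.
  rewrite ge0_fin_numE ?lp_norm_ge0//; apply: le_lt_trans (ltry 2).
  apply: lp_norm_le_sum => // -[|[|n]].
  - by rewrite big_ord0.
  - by rewrite big_ord1 u0; lra.
  - rewrite !big_ord_recl/= u0 u1 big1 => [|k _]; last exact: (u2 k).
    by rewrite addr0.
case: p p1 pfin => [q| |]//= p1 pfin; last first.
  apply/eqP; rewrite eq_le; apply/andP; split.
    by apply/lp_norm_le_sup => -[|[|k]]; rewrite ?u0 ?u1 ?u2.
  by have := lp_norm_ge_term u 0 p1; rewrite u0.
rewrite lee_fin in p1; have q0 : 0 < q by exact: lt_le_trans p1.
(* Partial sums are constant from length 2 on, which serves both the upper and the lower bound. *)
have sum_u n : \sum_(k < n.+2) `|u k| `^ q = 2.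
  rewrite !big_ord_recl/= u0 u1 !powR1 big1 => [|k _].
    by rewrite addr0.
  by rewrite [`|_|](u2 k) powR0 ?gt_eqF.
have root_two : (2 `^ q^-1) `^ q = 2 :> R.
  by rewrite -powRrM mulVf ?gt_eqF// powRr1.
apply/eqP; rewrite eq_le; apply/andP; split.
  apply/lp_norm_le_powR => //.
  move=> n; rewrite root_two -(sum_u n) -[n.+2]addn2 big_split_ord/= lerDl.
  by apply: sumr_ge0 => k _; exact: powR_ge0.
have B0 : 0 <= fine (lp_norm q%:E u) by rewrite fine_ge0 ?lp_norm_ge0.
have : (lp_norm q%:E u <= (fine (lp_norm q%:E u))%:E)%E by rewrite fineK.
move=> /(lp_norm_le_powR _ q0 B0)/(_ 2); rewrite sum_u -[leLHS]root_two.
rewrite -(fineK pfin) lee_fin => h; rewrite leNgt; apply/negP.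
by move=> /(gt0_ltr_powR q0); rewrite ltNge h// => /(_ _ _)/negP[]//; rewrite nnegrE ?powR_ge0.
Qed.

End lp_norm.

(** * Derivatives of the Morse potential at 1 and 2 *)

Section morse_derivatives.
Context {R : realType}.
Implicit Types (al r a b c : R).

(** This family is closed under differentiation, so differentiating the potential only updates
    coefficients. *)
Let expsum al a b c := fun r : R =>
  a * expR (- (2 * al * (r - r0 al))) + b * expR (- (al * (r - r0 al))) + c.

Let is_derive_expsum al a b c r : is_derive r 1 (expsum al a b c)
  (expsum al (- (2 * al) * a) (- al * b) 0 r).
Proof.
have h k : is_derive r 1 (fun t => expR (- (k * (t - r0 al))))
    (- k * expR (- (k * (r - r0 al)))).
  have hg : is_derive r 1 (fun t => - (k * (t - r0 al))) (- k).
    by apply: is_derive_eq; rewrite /GRing.scale/=; ring.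
  by have := is_derive1_comp (is_derive_expR _) hg; rewrite mulrC.
have h1 := h al; have h2 := h (2 * al).
apply: is_derive_eq.
by rewrite /GRing.scale/= /expsum; ring.
Qed.

Let phiE al : phi al = expsum al 1 (- 2) (- phi0 al).
Proof. by apply/funext => r; rewrite /phi /morse /expsum; ring. Qed.

Let derive1_expsum al a b c :
  derive1 (expsum al a b c) = expsum al (- (2 * al) * a) (- al * b) 0.
Proof. by apply/funext => r; rewrite derive1E; apply: derive_val. Qed.

(** One chain rule covers [gamma], [W] and their first derivatives, all of them combinations of f(t)
    and f(2t). *)
Lemma derive1_dilation (f : R -> R) a c r : (forall t, derivable f t 1) ->
  derive1 (fun t => a * f t + c * f (2 * t)) r =
  a * derive1 f r + 2 * c * derive1 f (2 * r).
Proof.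
move=> df.
have hf (t : R) : is_derive t 1 f (derive1 f t) by rewrite derive1E; apply: derivableP.
have hg : is_derive r 1 (fun t : R => 2 * t) 2.
  by apply: is_derive_eq; rewrite /GRing.scale/=; ring.
have hfg : is_derive r 1 (fun t : R => f (2 * t)) (derive1 f (2 * r) * 2).
  exact: is_derive1_comp (hf _) hg.
have h := is_deriveD (is_deriveZ a (hf r)) (is_deriveZ c hfg).
by rewrite derive1E (@derive_val _ _ _ _ _ _ _ h) /GRing.scale/=; ring.
Qed.

Let derive1_phi al :
  derive1 (phi al) = expsum al (- (2 * al)) (2 * al) 0.
Proof. by rewrite phiE derive1_expsum; congr expsum; ring. Qed.

Let derive2_phi al :
  derive1n 2 (phi al) = expsum al (4 * al ^+ 2) (- 2 * al ^+ 2) 0.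
Proof. by rewrite /= derive1_phi derive1_expsum; congr expsum; ring. Qed.

Let derivable_phi al r : derivable (phi al) r 1.
Proof. by rewrite phiE. Qed.

Let derivable_dphi al r : derivable (derive1 (phi al)) r 1.
Proof. by rewrite derive1_phi. Qed.

Lemma derive1_gamma al :
  derive1 (gamma al) = fun F => - derive1 (phi al) (2 * F).
Proof.
apply/funext => F.
rewrite (_ : gamma al = fun t => 0 * phi al t + - (1 / 2) * phi al (2 * t)).
  rewrite (derive1_dilation 0 (- (1 / 2)) F (@derivable_phi al)).
  by rewrite mul0r add0r (_ : 2 * - (1 / 2) = - 1) ?mulN1r//; field.
by apply/funext => t; rewrite mul0r add0r.
Qed.

Lemma derive2_gamma al F :
  derive1n 2 (gamma al) F = - 2 * derive1n 2 (phi al) (2 * F).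
Proof.
rewrite /= derive1_gamma.
rewrite (_ : (fun F => _) =
  fun t => 0 * derive1 (phi al) t + - 1 * derive1 (phi al) (2 * t)).
  rewrite (derive1_dilation 0 (- 1) F (@derivable_dphi al)).
  by rewrite mul0r add0r mulrN1.
by apply/funext => t; rewrite mul0r add0r mulN1r.
Qed.

Lemma derive2_W al r :
  derive1n 2 (W al) r = derive1n 2 (phi al) r + 4 * derive1n 2 (phi al) (2 * r).
Proof.
have W1 : derive1 (W al) =
    fun t => 1 * derive1 (phi al) t + 2 * derive1 (phi al) (2 * t).
  apply/funext => t.
  rewrite (_ : W al = fun t => 1 * phi al t + 1 * phi al (2 * t)).
    by rewrite (derive1_dilation 1 1 t (@derivable_phi al)) mulr1.
  by apply/funext => s; rewrite !mul1r.
rewrite /= W1.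
rewrite (derive1_dilation 1 2 r (@derivable_dphi al)) mul1r.
by rewrite (_ : 2 * 2 = 4); last by ring.
Qed.

(* [amp al] is exp (al (r0 - 1)). *)
Definition amp al : R :=
  (1 + 2 * expR (- al)) / (1 + 2 * expR (- al) ^+ 2).

Let expR_r0 al r : al != 0 ->
  expR (- (al * (r - r0 al))) = amp al * expR (- al * (r - 1)).
Proof.
move=> al0; have x0 := expR_gt0 (- al).
have -> : - (al * (r - r0 al)) = ln (amp al) + - al * (r - 1).
  rewrite /r0 /amp -expRM_natl mulrN; set L := ln _.
  by field.
rewrite expRD lnK// posrE /amp divr_gt0//; nra.
Qed.

Let expsum1 al a b : al != 0 ->
  expsum al a b 0 1 = a * amp al ^+ 2 + b * amp al.
Proof.
move=> al0; rewrite /expsum.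
rewrite (_ : - (2 * al * (1 - r0 al)) = 2 * (- (al * (1 - r0 al)))); last by ring.
by rewrite expRM_natl expR_r0// subrr mulr0 expR0; ring.
Qed.

Let expsum2 al a b : al != 0 ->
  expsum al a b 0 2 = a * (amp al * expR (- al)) ^+ 2 + b * (amp al * expR (- al)).
Proof.
move=> al0; rewrite /expsum.
rewrite (_ : - (2 * al * (2 - r0 al)) = 2 * (- (al * (2 - r0 al)))); last by ring.
rewrite expRM_natl expR_r0// (_ : 2 - 1 = 1 :> R); last by ring.
by rewrite mulr1; ring.
Qed.

Lemma derive1_phi2E al : al != 0 -> derive1 (phi al) 2 =
  2 * al * (amp al * expR (- al)) * (1 - amp al * expR (- al)).
Proof. by move=> al0; rewrite derive1_phi expsum2//; ring. Qed.

Lemma derive2_phi1E al : al != 0 ->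
  derive1n 2 (phi al) 1 = 2 * al ^+ 2 * amp al * (2 * amp al - 1).
Proof. by move=> al0; rewrite derive2_phi expsum1//; ring. Qed.

Lemma derive2_phi2E al : al != 0 -> derive1n 2 (phi al) 2 =
  - 2 * al ^+ 2 * (amp al * expR (- al)) * (1 - 2 * (amp al * expR (- al))).
Proof. by move=> al0; rewrite derive2_phi expsum2//; ring. Qed.

End morse_derivatives.

(** * Explicit expansions in x = exp (-al) and in b *)

Section asymptotics.
Context {R : realType}.
Implicit Types (al b s : R) (h : nat).

Lemma amp_bounds al (x := expR (- al)) : x <= 1 / 20 ->
  1 <= amp al <= 1 + 2 * x.
Proof.
move=> x_small; have x0 : 0 < x := expR_gt0 _.
by rewrite /amp -/x ler_pdivlMr ?ler_pdivrMr; nra.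
Qed.

(** With A = [amp al] in [1, 1 + 2x], -beta = x (1 - 2Ax) / (2A - 1). The quotient is at least 1 -
    6x to first order; 7 leaves slack. *)
Lemma beta_bounds al (x := expR (- al)) : al != 0 -> x <= 1 / 20 ->
  x - 7 * x ^+ 2 <= - beta al <= x.
Proof.
move=> al0 x_small; have x0 : 0 < x := expR_gt0 _.
have := amp_bounds x_small; rewrite -/x => /andP[A1 A2].
have -> : - beta al = x * (1 - 2 * (amp al * x)) / (2 * amp al - 1).
  rewrite /beta derive2_phi2E// derive2_phi1E// -/x.
  by field; rewrite al0/= !gt_eqF//; lra.
rewrite ler_pdivlMr ?ler_pdivrMr; [|lra|lra].
have Ax : amp al * x <= (1 + 2 * x) * x by rewrite ler_wpM2r// ltW.
have Ax0 : 0 <= amp al * x by rewrite mulr_ge0 ?ltW//; lra.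
apply/andP; split; last by rewrite ler_wpM2l ?(ltW x0)//; lra.
rewrite (_ : x - 7 * x ^+ 2 = x * (1 - 7 * x)); last by ring.
rewrite -mulrA ler_wpM2l ?(ltW x0)//.
have : (1 - 7 * x) * (2 * amp al - 1) <= (1 - 7 * x) * (1 + 4 * x).
  by rewrite ler_wpM2l//; lra.
by nra.
Qed.

(** Since 4 beta = (s - 1)(s + 1), the factor (s - 1)/2 cancels, leaving a form that stays regular
    as beta tends to 0. *)
Lemma lambda_sqrt al (s := Num.sqrt (1 + 4 * beta al)) :
  - (1 / 20) <= beta al < 0 -> lambda al = (1 - s) / (1 + s).
Proof.
move=> /andP[b1 b0]; have s0 : 0 <= s := sqrtr_ge0 _.
have s2 : s ^+ 2 = 1 + 4 * beta al by rewrite sqr_sqrtr//; lra.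
have -> : lambda al = (s - 1 - 2 * beta al) / (2 * beta al) by [].
have bE : beta al = (s ^+ 2 - 1) / 4 by rewrite s2; field.
by apply/eqP; rewrite eqr_div; [apply/eqP; rewrite bE; field| |]; lra.
Qed.

(** Here (1 - s)/(1 + s) = 4b / (1 + s)^2, with 1 + s between 2 - 4b and 2. *)
Lemma lambda_bounds b s : 0 < b <= 1 / 20 -> 0 <= s -> s ^+ 2 = 1 - 4 * b ->
  [/\ s <= 1, b <= (1 - s) / (1 + s) & (1 - s) / (1 + s) <= b + 12 * b ^+ 2].
Proof.
move=> /andP[b0 b1] s0 s2; have s1 : s <= 1 by nra.
have bE : b = (1 - s) * (1 + s) / 4 by lra.
have sb : 1 - s <= 4 * b by nra.
split=> //; first by rewrite ler_pdivlMr; nra.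
rewrite ler_pdivrMr; last lra.
nra.
Qed.

(** From (1 + s)/2 = 1 - b - b lam, the difference is b (2b - lam) / (1 - 2b), which is quadratic
    because b <= lam <= 2b. *)
Lemma cell_ratio_one_dist b s (lam := (1 - s) / (1 + s)) :
  0 < b <= 1 / 20 -> 0 <= s -> s ^+ 2 = 1 - 4 * b -> lam <= 2 * b ->
  `|(1 + s) / 2 / (1 - 2 * b) - 1 - b| <= 8 * b ^+ 2.
Proof.
move=> bb s0 s2 lam2; have /andP[b0 b1] := bb.
have [s1 lam1 _] := lambda_bounds bb s0 s2.
have bE : b = (1 - s) * (1 + s) / 4 by lra.
have -> : (1 + s) / 2 / (1 - 2 * b) - 1 - b = b * (2 * b - lam) / (1 - 2 * b).
  have : (1 + s) / 2 = 1 - b - b * lam by rewrite bE /lam; field; lra.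
  by move=> ->; field; lra.
rewrite -/lam in lam1.
rewrite ger0_norm; last by rewrite divr_ge0 ?mulr_ge0//; lra.
by rewrite ler_pdivrMr; nra.
Qed.

(** The weight [h%:R] counts the sites of the first cell, over which the error in the ratio is
    summed. *)
Lemma cell_ratio_dist b s h : (1 < h)%N ->
  0 < b <= 1 / 20 -> 0 <= s -> s ^+ 2 = 1 - 4 * b ->
  h%:R * `|(1 + s) / 2 / (h%:R * (1 - 4 * b) + 2 * b) - h%:R^-1| <= 8 * b.
Proof.
move=> h1 bb s0 s2; have /andP[b0 b1] := bb.
have [s1 _ _] := lambda_bounds bb s0 s2.
have sb : 1 - s <= 4 * b by nra.
have H2 : 2 <= h%:R :> R by rewrite ler_nat.
set H : R := h%:R in H2 *.
have D0 : H / 2 <= H * (1 - 4 * b) + 2 * b by nra.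
have -> : (1 + s) / 2 / (H * (1 - 4 * b) + 2 * b) - H^-1 =
    (H * ((s - 1) / 2 + 4 * b) - 2 * b) / (H * (H * (1 - 4 * b) + 2 * b)).
  by field; rewrite !gt_eqF//; lra.
(* By [sb] the bracket is at least 2b. *)
have N0 : 0 <= H * ((s - 1) / 2 + 4 * b) - 2 * b by nra.
have HD : 0 < H * (H * (1 - 4 * b) + 2 * b) by rewrite mulr_gt0; lra.
rewrite ger0_norm; last by rewrite divr_ge0// ltW.
rewrite mulrA ler_pdivrMr//.
rewrite [leRHS](_ : _ = H * (8 * b * (H * (1 - 4 * b) + 2 * b))); last by ring.
rewrite ler_wpM2l; [by []|lra|].
nra.
Qed.

End asymptotics.

(** * The relative error as a quotient of norms close to explicit profiles *)

Section relative_error.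
Context {R : realType}.
Implicit Types (p : \bar R) (al lam rho x : R) (X : nat -> nat) (h n : nat).

Lemma uscbE al X l : X 0%N = 0%N -> (forall j, (X j < X j.+1)%N) ->
  uscb al X l = Uscb al X 0 * (l < mesh_size X 0)%:R.
Proof.
move=> X0 Xincr; rewrite /uscb /interpolate /mesh_size X0 subn0.
have Xmono : {homo X : i j / (i <= j)%N} by apply: homo_leq leq_trans _ => // i; exact: ltnW.
have [lX|Xl] := ltnP l (X 1%N).
  rewrite big1 ?mulr1// => j Xjl; apply/eqP; rewrite -leqn0 -ltnS.
  rewrite ltnNge; apply/negP => /Xmono Xj.
  by move: (leq_trans Xj Xjl); rewrite leqNgt lX.
(* Positivity of [l] puts index 1 in the search range [j < l.+1], so the maximum is positive and
   [Uscb] vanishes there. *)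
have l0 : (0 < l)%N by apply: leq_trans Xl; have := Xincr 0%N; rewrite X0.
rewrite mulr0; set m := (\max_(_ < _ | _) _)%N.
suff : (0 < m)%N by case: (m).
have l1 : (1 < l.+1)%N by [].
exact: (@leq_bigmax_cond _ _ (fun j : 'I_l.+1 => j : nat) (Ordinal l1) Xl).
Qed.

Lemma sum_ind_lt_le h n : \sum_(k < n) (k < h)%:R <= h%:R :> R.
Proof.
elim: n h => [|n IH] [|h]; rewrite ?big_ord0//.
  by rewrite big1.
by rewrite big_ord_recl/= -[h.+1%:R]natr1 addrC lerD2r; exact: IH.
Qed.

Lemma sum_geometric_le lam n : 0 <= lam <= 1 / 2 -> \sum_(k < n) lam ^+ k <= 2.
Proof.
move=> /andP[l0 l1]; have := subrX1 lam n; set S := \sum_(_ < _) _ => E.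
have : 0 <= lam ^+ n by exact: exprn_ge0.
nra.
Qed.

(** The cell contributes [h] equal deviations, and the geometric sequence differs from a unit mass
    at 0 by a tail of size at most 2 lam. *)
Lemma sum_cell_dist_le rho lam h n : (0 < h)%N -> 0 <= lam <= 1 / 2 ->
  \sum_(k < n) `|(rho * (k < h)%:R - lam ^+ k)
                 - (h%:R^-1 * (k < h)%:R - (k == 0%N :> nat)%:R)| <=
  h%:R * `|rho - h%:R^-1| + 2 * lam.
Proof.
move=> h0 l01; have /andP[l0 l1] := l01.
apply: (@le_trans _ _ (\sum_(k < n) `|rho - h%:R^-1| * (k < h)%:R
    + \sum_(k < n) `|lam ^+ k - (k == 0%N :> nat)%:R|)).
  rewrite -big_split; apply: ler_sum => k _ /=.
  rewrite -[X in `|_| * X]ger0_norm// -normrM -[leRHS]/(`|_| + `|_|).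
  rewrite [X in _ <= _ + X]distrC; apply: le_trans (ler_normD _ _).
  by rewrite le_eqVlt; apply/orP; left; apply/eqP; congr `|_|; ring.
apply: lerD; first by rewrite -mulr_sumr mulrC ler_wpM2r ?sum_ind_lt_le.
case: n => [|n]; first by rewrite big_ord0 mulr_ge0.
rewrite big_ord_recl/= subrr normr0 add0r.
under eq_bigr do rewrite subr0 exprS normrM (ger0_norm l0) ger0_norm ?exprn_ge0//.
by rewrite -mulr_sumr mulrC ler_wpM2r ?sum_geometric_le.
Qed.

(** The three terms come from site 0, site 1 and the geometric tail from site 2 on. *)
Lemma sum_dipole_dist_le rho lam x n : 0 <= lam <= 1 / 2 ->
  \sum_(k < n) `|(rho * (k < 1)%:R - lam ^+ k)
                 - x * ((k == 0%N :> nat)%:R - (k == 1%N :> nat)%:R)| <=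
  `|rho - 1 - x| + `|lam - x| + 2 * lam ^+ 2.
Proof.
move=> l01; have /andP[l0 l1] := l01.
have lam2 := sqr_ge0 lam.
case: n => [|[|n]].
- by rewrite big_ord0 !addr_ge0// mulr_ge0.
- rewrite big_ord1/= expr0 mulr1 subr0 mulr1. rewrite -[leRHS]addrA lerDl.
  by rewrite addr_ge0// mulr_ge0.
rewrite !big_ord_recl/= expr0.
rewrite !(mulr1, mulr0) subr0 mulr1 -[leRHS]addrA lerD// lerD//.
  by rewrite expr1 !sub0r mulrN1 opprK addrC distrC.
under eq_bigr => k _.
  rewrite (_ : `|_| = lam ^+ 2 * lam ^+ k); last first.
    by rewrite !(subrr, mulr0, subr0, sub0r) normrN ger0_norm ?exprn_ge0// -exprD.
  over.
by rewrite -mulr_sumr mulrC ler_wpM2r ?sum_geometric_le.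
Qed.

Lemma beta_itv al : al != 0 -> expR (- al) <= 1 / 20 -> 0 < - beta al <= 1 / 20.
Proof.
move=> al0 x_small; have x0 := expR_gt0 (- al).
have /andP[b1 b2] := beta_bounds al0 x_small.
apply/andP; split; last lra.
by apply: lt_le_trans b1; nra.
Qed.

Lemma geometric_lp_fin p lam : (1 <= p)%E -> 0 <= lam <= 1 / 2 ->
  (lp_norm p (fun k => lam ^+ k)%R < +oo)%E.
Proof.
move=> p1 l01; have /andP[l0 _] := l01; apply: le_lt_trans (ltry 2).
apply: lp_norm_le_sum => // n.
by under eq_bigr do rewrite ger0_norm ?exprn_ge0//; exact: sum_geometric_le.
Qed.

Lemma cell_lp_fin p rho lam h : (1 <= p)%E -> 0 <= lam <= 1 / 2 ->
  (lp_norm p (fun k => rho * (k < h)%:R - lam ^+ k)%R < +oo)%E.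
Proof.
move=> p1 l01; have /andP[l0 _] := l01.
apply: le_lt_trans (ltry (`|rho| * h%:R + 2)).
apply: lp_norm_le_sum => // n.
apply: (@le_trans _ _ (\sum_(k < n) `|rho| * (k < h)%:R + \sum_(k < n) lam ^+ k)).
  rewrite -big_split; apply: ler_sum => k _ /=.
  apply: le_trans (ler_normB _ _) _.
  by rewrite normrM [`|_%:R|]ger0_norm// [`|lam ^+ _|]ger0_norm ?exprn_ge0.
by rewrite lerD ?sum_geometric_le// -mulr_sumr ler_wpM2l ?sum_ind_lt_le.
Qed.

(* Up to the common nonzero factor [kappa], the atomistic solution is the
   geometric sequence [lambda ^+ k] and the surface Cauchy-Born solution is
   [rho] on the first cell. *)
Lemma ErrE p al X : (1 <= p)%E -> X 0%N = 0%N -> (forall j, (X j < X j.+1)%N) ->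
  0 < al -> expR (- al) <= 1 / 20 -> 0 <= lambda al <= 1 / 2 ->
  let h := mesh_size X 0 in let b := - beta al in
  let s := Num.sqrt (1 - 4 * b) in
  let rho := (1 + s) / 2 / (h%:R * (1 - 4 * b) + 2 * b) in
  Err X p al =
  fine (lp_norm p (fun k => rho * (k < h)%:R - lambda al ^+ k)) /
  fine (lp_norm p (fun k => lambda al ^+ k)).
Proof.
move=> p1 X0 Xincr al_gt0 x_small l01 h b s rho.
have al0 : al != 0 by rewrite gt_eqF.
have x0 := expR_gt0 (- al).
have /andP[b0 b1] : 0 < b <= 1 / 20 := beta_itv al0 x_small.
have s0 : 0 <= s := sqrtr_ge0 _.
have s2 : s ^+ 2 = 1 - 4 * b by rewrite sqr_sqrtr//; lra.
have lamE : lambda al = (1 - s) / (1 + s).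
  rewrite lambda_sqrt; last by rewrite /b in b0 b1; lra.
  by rewrite /s /b mulrN opprK.
have /andP[A1 A2] := amp_bounds x_small.
set f1 : R := derive1n 2 (phi al) 1; set f2 : R := derive1n 2 (phi al) 2.
set d : R := derive1 (phi al) 2.
have f1_neq0 : f1 != 0.
  by rewrite /f1 derive2_phi1E// gt_eqF// !mulr_gt0//; lra.
have d_neq0 : d != 0.
  by rewrite /d derive1_phi2E// gt_eqF// !mulr_gt0//; nra.
have f2E : f2 = - b * f1 by rewrite /b opprK /beta -/f1 -/f2 divfK.
have H0 : 0 < h%:R * (1 - 4 * b) + 2 * b.
  by rewrite ltr_wpDl ?mulr_ge0//; lra.
have bE : b = (1 - s) * (1 + s) / 4 by lra.
(* As f2 = -b f1 and 1 - b (1 + lambda) = (1 + s)/2, this is the value of [ua al] at site 0. *)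
pose kappa := d / (f1 * ((1 + s) / 2)).
have kappa0 : kappa != 0.
  by rewrite mulf_neq0// invr_eq0 mulf_neq0// gt_eqF//; lra.
have uaE k : ua al k = kappa * lambda al ^+ k.
  rewrite /ua -/d -/f1 -/f2 f2E /kappa mulrAC; congr (_ / _ * _).
  by rewrite lamE bE; field; rewrite gt_eqF//; lra.
have uscb_cell k : uscb al X k = kappa * (rho * (k < h)%:R).
  rewrite uscbE// mulrA; congr (_ * _).
  rewrite /Uscb derive1_gamma derive2_gamma derive2_W mulr1 opprK.
  rewrite -/h -/d -/f1 -/f2 f2E /kappa /rho.
  set D := _ + 2 * b in H0 *.
  (* The denominator is h (f1 + 4 f2) - 2 f2 with f2 = -b f1. *)
  rewrite (_ : _ + _ = f1 * D); last by rewrite /D; ring.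
  by field; rewrite f1_neq0/= !gt_eqF//; lra.
rewrite /Err.
rewrite (_ : (fun l => _) = fun k => kappa * (rho * (k < h)%:R - lambda al ^+ k)).
  rewrite (_ : ua al = fun k => kappa * lambda al ^+ k); last exact/funext.
  rewrite !lp_normZ ?geometric_lp_fin ?cell_lp_fin//.
  by rewrite -mulf_div divff ?mul1r// normr_eq0.
by apply/funext => k; rewrite uaE uscb_cell mulrBr.
Qed.

(** D/G - c = (D - c - c (G - 1)) / G, and dividing by G >= 1 only helps. *)
Lemma quotient_dist (D G c d g : R) : 1 <= G -> `|D - c| <= d -> `|G - 1| <= g ->
  `|D / G - c| <= d + `|c| * g.
Proof.
move=> G1 Dc Gg.
have -> : D / G - c = (D - c - c * (G - 1)) / G by field; lra.
rewrite normrM normfV [`|G|]ger0_norm; last lra.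
rewrite ler_pdivrMr; last lra.
have d0 : 0 <= d + `|c| * g by rewrite addr_ge0 ?mulr_ge0 ?(le_trans _ Dc) ?(le_trans _ Gg).
apply: (@le_trans _ _ (d + `|c| * g)); last by rewrite ler_peMr.
apply: (le_trans (ler_normB _ _)); rewrite normrM lerD//.
by rewrite ler_wpM2l.
Qed.

(** Chains the expansions of lambda in b and of b in x; 19 adds their constants 12 and 7. *)
Lemma lambda_dist al (x := expR (- al)) : al != 0 -> x <= 1 / 20 ->
  [/\ 0 <= lambda al <= 1 / 2, lambda al <= 2 * x & `|lambda al - x| <= 19 * x ^+ 2].
Proof.
move=> al0 x_small; have x0 : 0 < x := expR_gt0 _.
have bb := beta_itv al0 x_small; set b := - beta al in bb *.
have := beta_bounds al0 x_small; rewrite -/x -/b => /andP[b1 b2].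
have s2 : Num.sqrt (1 - 4 * b) ^+ 2 = 1 - 4 * b.
  by rewrite sqr_sqrtr//; lra.
have [s1] := lambda_bounds bb (sqrtr_ge0 _) s2.
have -> : (1 - Num.sqrt (1 - 4 * b)) / (1 + Num.sqrt (1 - 4 * b)) = lambda al.
  rewrite lambda_sqrt; last by rewrite /b in bb; lra.
  by rewrite /b mulrN opprK.
move=> l1 l2; have bx : b ^+ 2 <= x ^+ 2 by rewrite !expr2 ler_pM//; lra.
have xx : x ^+ 2 <= x / 20 by nra.
by split; [apply/andP; split| |rewrite ler_norml; apply/andP; split]; lra.
Qed.

(** Site 0 alone gives the lower bound 1; the l^1 norm gives the upper bound. *)
Lemma geometric_lp_dist p lam : (1 <= p)%E -> 0 <= lam <= 1 / 2 ->
  1 <= fine (lp_norm p (fun k => lam ^+ k)) /\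
  `|fine (lp_norm p (fun k => lam ^+ k)) - 1| <= 2 * lam.
Proof.
move=> p1 l01; have /andP[l0 _] := l01.
have lfin := geometric_lp_fin p1 l01.
set G := lp_norm _ _ in lfin *.
have Gfin : G \is a fin_num by rewrite ge0_fin_numE ?lp_norm_ge0.
have G1 : 1 <= fine G.
  rewrite -lee_fin fineK//.
  by have := lp_norm_ge_term (fun k => lam ^+ k) 0 p1; rewrite expr0 normr1.
split=> //; rewrite ger0_norm ?subr_ge0// lerBlDl -lee_fin fineK//.
apply: lp_norm_le_sum => // -[|n]; first by rewrite big_ord0; lra.
rewrite big_ord_recl expr0 normr1 lerD2l.
under eq_bigr do rewrite /= exprS ger0_norm ?mulr_ge0 ?exprn_ge0//.
by rewrite -mulr_sumr mulrC ler_wpM2r ?sum_geometric_le.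
Qed.

End relative_error.

(** * Assembly of the two regimes, with explicit error constants *)

Theorem proposition4 (R : realType) (p : \bar R) (X : nat -> nat)
    (p_ge1 : (1 <= p)%E)
    (X0 : X 0%N = 0%N)
    (X_incr : forall j : nat, (X j < X j.+1)%N) :
  ((1 < mesh_size X 0)%N ->
     exists C : R, 1 / 2 <= C <= 2 /\
       exists K : R, \forall al \near +oo%R,
         `|Err X p al - C| <= K * expR (- al)) /\
  (mesh_size X 0 = 1%N ->
     exists K : R, \forall al \near +oo%R,
       `|Err X p al - two_root p * expR (- al)| <= K * expR (- (2 * al))).
Proof.
have small_x : \forall al \near +oo%R, 0 < al /\ expR (- al) <= 1 / 20 :> R.
  near=> al.
  have al20 : 20 <= al by near: al; exact: nbhs_pinfty_ge.
  split; first lra.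
  have := expR_ge1Dx al; rewrite expRN div1r => e.
  by rewrite lef_pV2 ?posrE ?expR_gt0//; lra.
split=> [h1|h1].
  set h := mesh_size X 0 in h1 *.
  have H2 : 2 <= h%:R :> R by rewrite ler_nat.
  have HV : (h%:R : R)^-1 <= 1 / 2 by rewrite div1r lef_pV2 ?posrE//; lra.
  have HV0 : 0 <= (h%:R : R)^-1 by rewrite invr_ge0.
  (* The limiting error profile, whose norm is the witness for [C]. Its l^1 norm is at most 1 + 1,
     and its entry at site 0 has modulus 1 - 1/h >= 1/2. *)
  pose v k : R := h%:R^-1 * (k < h)%:R - (k == 0%N)%:R.
  have vle : (lp_norm p v <= 2%:E)%E.
    apply: lp_norm_le_sum => // n.
    apply: (@le_trans _ _ (\sum_(k < n) h%:R^-1 * (k < h)%:R + \sum_(k < n) (k < 1)%:R)).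
      rewrite -big_split; apply: ler_sum => k _ /=.
      apply: le_trans (ler_normB _ _) _.
      by rewrite normrM !ger0_norm// ltnS leqn0.
    rewrite [leRHS](_ : _ = h%:R^-1 * h%:R + 1%:R); last by rewrite mulVf// gt_eqF//; lra.
    by rewrite lerD ?sum_ind_lt_le// -mulr_sumr ler_wpM2l ?sum_ind_lt_le.
  have vfin : (lp_norm p v < +oo)%E := le_lt_trans vle (ltry _).
  have vfn : lp_norm p v \is a fin_num by rewrite ge0_fin_numE ?lp_norm_ge0.
  have C2 : fine (lp_norm p v) <= 2 by rewrite -lee_fin fineK.
  have C1 : 1 / 2 <= fine (lp_norm p v).
    rewrite -lee_fin fineK//; apply: le_trans (lp_norm_ge_term v 0 p_ge1).
    by rewrite lee_fin /v (ltn_trans _ h1)//= mulr1 distrC ger0_norm; lra.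
  exists (fine (lp_norm p v)); split; first by rewrite C1.
  (* 20 = 8 + 4 + 8: the cell ratio, the tail 2 lambda, and [C] times the deviation 2 lambda of the
     denominator, with lambda <= 2x and C <= 2. *)
  exists 20; near=> al.
  have [al_gt0 x_small] : 0 < al /\ expR (- al) <= 1 / 20 by near: al.
  have al0 : al != 0 by rewrite gt_eqF.
  have x0 := expR_gt0 (- al).
  have bb := beta_itv al0 x_small.
  have /andP[_ bx] := beta_bounds al0 x_small.
  have [l01 lx _] := lambda_dist al0 x_small.
  have [G1 Gg] := geometric_lp_dist p_ge1 l01.
  rewrite ErrE// -/h.
  have s2 : Num.sqrt (1 - 4 * - beta al) ^+ 2 = 1 - 4 * - beta al.
    by rewrite sqr_sqrtr//; lra.
  have rho_le := cell_ratio_dist h1 bb (sqrtr_ge0 _) s2.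
  set rho := (_ / _ / _) in rho_le *.
  have Dd := lp_norm_dist
    (u := fun k => rho * (k < h)%:R - lambda al ^+ k) p_ge1 vfin
    (fun n => sum_cell_dist_le rho n (ltnW h1) l01).
  apply: le_trans (quotient_dist G1 Dd Gg) _.
  rewrite [`|fine _|]ger0_norm; last lra.
  set C := fine _ in C1 C2 *; set d := _ * `|_| in rho_le *.
  have : C * (2 * lambda al) <= 2 * (4 * expR (- al)).
    by rewrite ler_pM//; lra.
  by lra.
(* 50 = 15 + 19 + 8 + 8: site 0, site 1, the tail 2 lambda^2, and the denominator correction. *)
exists 50; near=> al.
have [al_gt0 x_small] : 0 < al /\ expR (- al) <= 1 / 20 by near: al.
have al0 : al != 0 by rewrite gt_eqF.
have x0 := expR_gt0 (- al).
have -> : expR (- (2 * al)) = expR (- al) ^+ 2 by rewrite -mulrN expRM_natl.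
have bb := beta_itv al0 x_small.
have /andP[bx1 bx] := beta_bounds al0 x_small.
have [l01 lx lxx] := lambda_dist al0 x_small.
have [G1 Gg] := geometric_lp_dist p_ge1 l01.
rewrite ErrE// h1.
have s2 : Num.sqrt (1 - 4 * - beta al) ^+ 2 = 1 - 4 * - beta al.
  by rewrite sqr_sqrtr//; lra.
set x := expR (- al) in x0 x_small bx1 bx lx lxx *.
set b := - beta al in bb bx1 bx s2 *.
have lE : lambda al = (1 - Num.sqrt (1 - 4 * b)) / (1 + Num.sqrt (1 - 4 * b)).
  rewrite lambda_sqrt; last by rewrite /b in bb; lra.
  by rewrite /b mulrN opprK.
have [_ l1 l2] := lambda_bounds bb (sqrtr_ge0 _) s2.
have rho_le : `|(1 + Num.sqrt (1 - 4 * b)) / 2 / (1 - 2 * b) - 1 - b| <= 8 * b ^+ 2.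
  by apply: cell_ratio_one_dist => //; nra.
rewrite (_ : 1%:R * (1 - 4 * b) + 2 * b = 1 - 2 * b); last by ring.
set rho := (_ / _ / _) in rho_le *.
have dip := lp_norm_dipole p_ge1.
have dip2 : two_root p <= 2 :> R.
  case: (p) p_ge1 => [q| |]//=; last by lra.
  rewrite lee_fin => q1; rewrite -[leRHS]powRr1//.
  by rewrite ler_powR ?invf_le1//; lra.
have dip0 : 0 <= two_root p :> R by rewrite -lee_fin -dip lp_norm_ge0.
have cE : fine (lp_norm p (fun k => x * ((k == 0%N)%:R - (k == 1%N)%:R))) =
    two_root p * x.
  by rewrite lp_normZ ?dip ?ltry ?gt_eqF//= gtr0_norm// mulrC.
have vfin : (lp_norm p (fun k => x * ((k == 0%N)%:R - (k == 1%N)%:R))%R < +oo)%E.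
  by apply: le_lt_trans (lp_norm_leZ _ p_ge1 _) _; rewrite ?dip ltry.
have Dd := lp_norm_dist
  (u := fun k => rho * (k < 1)%:R - lambda al ^+ k) p_ge1 vfin
  (fun n => sum_dipole_dist_le rho x n l01).
rewrite cE in Dd.
apply: le_trans (quotient_dist G1 Dd Gg) _.
(* 15 = 8 + 7, from [rho_le] and from replacing b by x. *)
have rx : `|rho - 1 - x| <= 15 * x ^+ 2.
  rewrite (_ : rho - 1 - x = (rho - 1 - b) + (b - x)); last by ring.
  apply: le_trans (ler_normD _ _) _.
  have : `|b - x| <= 7 * x ^+ 2 by rewrite ler_norml; lra.
  nra.
rewrite [`|two_root p * x|]ger0_norm; last by rewrite mulr_ge0// ltW.
have tx : two_root p * x * (2 * lambda al) <= 2 * x * (4 * x).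
  apply: ler_pM; [by rewrite mulr_ge0 ?(ltW x0)|lra| |lra].
  by rewrite ler_wpM2r ?(ltW x0).
nra.
Unshelve. all: by end_near. Qed.
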